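(* Let $(a_n)_{n\ge1}$ and $(b_n)_{n\ge1}$ be sequences of positive integers, and put $A_n=\sum_{j=1}^n a_j$, $B_n=\sum_{j=1}^n b_j$, $B_0=0$. Let $\{S_k\}_{k\ge0}$ be the inhomogeneous random walk in $\mathbb{Z}^2$ started at the origin which does $a_1$ diagonal steps, then $b_1$ horizontal steps, then $a_2$ diagonal steps, then $b_2$ horizontal steps, and so on. If $$\sum_{n\ge1}\frac{1}{\sqrt{A_n}}\,\frac{\sqrt{A_n+B_n}-\sqrt{A_n+B_{n-1}}}{\sqrt{b_n}}<\infty$$ and $$\sum_{n=1}^\infty \frac{1}{\log a_{n+1}}\sum_{j=1}^{a_{n+1}} (B_n+A_n+j)^{-1/2}(A_n+j)^{-1/2}<\infty ,$$ then $\{S_k\}$ is transient. In particular, these two conditions hold for $a_n=n^2$ and $b_n=2^n$.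
   Context: All steps of the walk are independent. A diagonal step is uniformly distributed on the four vectors $(\pm1,\pm1)$; a horizontal step is uniformly distributed on the two vectors $(\pm1,0)$. Transient means that almost surely $S_k=0$ for only finitely many $k$. The convention $1/\log 1=+\infty$ is used, so the second condition requires $a_{n+1}\ge2$ for all $n\ge1$. *)

(* Defs.v *)
From mathcomp Require Import all_boot all_order all_algebra.
From mathcomp Require Import all_classical all_reals all_analysis.
Set Implicit Arguments.
Unset Strict Implicit.
Unset Printing Implicit Defensive.
Import Order.TTheory GRing.Theory Num.Theory.
Import numFieldNormedType.Exports.
Local Open Scope classical_set_scope.
Local Open Scope ring_scope.

Notation Z2 := (int * int)%type.

(* Sequences (a_n)_{n >= 1} are functions on nat whose value at 0 is never
   used: psum a n = a_1 + ... + a_n. *)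
Definition psum (a : nat -> nat) (n : nat) : nat :=
  (\sum_(1 <= j < n.+1) a j)%N.

Definition positive_seq (a : nat -> nat) : Prop :=
  forall n : nat, (1 <= n)%N -> (0 < a n)%N.

Section random_variables.
Context (d : measure_display) (T : measurableType d) (R : realType).
Variable P : probability T R.

(* Z2 carries the discrete sigma-algebra: every set of values is an event. *)
Definition random_vector (X : T -> Z2) : Prop :=
  forall E : set Z2, measurable (X @^-1` E).

Definition mutually_independent (X : nat -> T -> Z2) : Prop :=
  forall (J : seq nat) (E : nat -> set Z2), uniq J ->
    P (\bigcap_(k in [set` J]) (X k @^-1` E k))
    = (\prod_(k <- J) P (X k @^-1` E k))%E.

(* The list D is meant to be duplicate-free. *)
Definition uniform_on (D : seq Z2) (X : T -> Z2) : Prop :=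
  forall v : Z2,
    P (X @^-1` [set v]) = (if v \in D then (size D)%:R^-1 else 0)%:E.

End random_variables.

Definition diagonal_vectors : seq Z2 :=
  [:: (1, 1); (1, -1); (-1, 1); (-1, -1)].

Definition horizontal_vectors : seq Z2 := [:: (1, 0); (-1, 0)].

(* Step k leads from S_k to S_{k+1}.  The (n+1)-st run of diagonal steps starts
   at time A_n + B_n and the (n+1)-st run of horizontal steps at time
   A_{n+1} + B_n. *)
Definition diagonal_time (a b : nat -> nat) (k : nat) : Prop :=
  exists n : nat, (psum a n + psum b n <= k < psum a n.+1 + psum b n)%N.

Definition horizontal_time (a b : nat -> nat) (k : nat) : Prop :=
  exists n : nat, (psum a n.+1 + psum b n <= k < psum a n.+1 + psum b n.+1)%N.

Definition steps (T : Type) (S : nat -> T -> Z2) (k : nat) (w : T) : Z2 :=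
  S k.+1 w - S k w.

Record diag_horiz_walk d (T : measurableType d) (R : realType)
    (P : probability T R) (a b : nat -> nat) (S : nat -> T -> Z2) : Prop := {
  walk_random_vector : forall k, random_vector (S k);
  walk_start : forall w, S 0%N w = 0;
  walk_independent : mutually_independent P (steps S);
  walk_diagonal : forall k, diagonal_time a b k ->
    uniform_on P diagonal_vectors (steps S k);
  walk_horizontal : forall k, horizontal_time a b k ->
    uniform_on P horizontal_vectors (steps S k) }.

Definition transient d (T : measurableType d) (R : realType)
    (P : probability T R) (S : nat -> T -> Z2) : Prop :=
  {ae P, forall w, finite_set [set k : nat | S k w = 0]}.

Section series.
Variables (R : realType) (a b : nat -> nat).
Local Notation A := (psum a).
Local Notation B := (psum b).

Definition horizontal_series : \bar R :=
  (\sum_(1 <= n <oo)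
    ((Num.sqrt (A n)%:R)^-1 *
     ((Num.sqrt (A n + B n)%:R - Num.sqrt (A n + B n.-1)%:R)
      / Num.sqrt (b n)%:R))%:E)%E.

(* The inverse of the logarithm is taken in \bar R, where 0^-1 = +oo. *)
Definition diagonal_series : \bar R :=
  (\sum_(1 <= n <oo)
    ((ln (a n.+1)%:R)%:E^-1 *
     (\sum_(1 <= j < (a n.+1).+1)
        (B n + A n + j)%:R `^ (- 2^-1) * (A n + j)%:R `^ (- 2^-1))%:E))%E.

End series.

(* Main.v *)
Require Import Defs.
From mathcomp Require Import all_boot all_order all_algebra.
From mathcomp Require Import all_classical all_reals all_analysis.
From mathcomp Require Import zify ring lra.
Set Implicit Arguments.
Unset Strict Implicit.
Unset Printing Implicit Defensive.
Import Order.TTheory GRing.Theory Num.Theory.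
Local Open Scope classical_set_scope.
Local Open Scope ring_scope.

(** The series hypotheses are exactly what Borel-Cantelli needs.  For n >= 1 the
    time interval from A_n + B_{n-1} to A_{n+1} + B_n consists of a horizontal
    run of length b_n followed by a diagonal run of length a_{n+1}; these
    intervals cover all but finitely many times, so it suffices that the
    probabilities of a zero of S inside them are summable
    ([transient_of_series]).

    A run is treated by comparing the chance of hitting 0 with the expected
    number of visits to 0.  If all steps of a run of length m have the law D and
    the walk hits 0 in the run, then the walk which keeps making steps of law D
    visits 0 on average at least G_m(0) times in the m steps after the hit,
    where G_m(x) is the mean number of visits to 0 up to time m of the walk with
    steps of law D started at x.  Hence
      P(S hits 0 in the run) * G_m(0) <= E[G_{2m}(S_t)],
    with t the starting time of the run ([pr_zero_between_le]).  The walk that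
    continues beyond the end of the run never has to be constructed: G_{2m} is
    a function on Z^2 and the inequality is proved by induction on the length of
    the run, from the first-step equation G_{M+1} = delta_0 + Q_D G_M
    ([cylinder_zero_le_green]).

    Both sides are explicit.  The two coordinates of a diagonal step are
    independent signs, so averaging over a step acts on a product f(x) g(y) by
    the simple random walk operator f(x) |-> (f(x+1) + f(x-1)) / 2 on both
    factors for a diagonal step, and on the first factor only for a horizontal
    one.  So, with p(n) the probability that simple random walk on Z is at 0 at
    time n and A the number of diagonal steps before time t, E[G_{2m}(S_t)] is
    the sum over j <= 2m of p(t+j) p(A) for a horizontal run and of
    p(t+j) p(A+j) for a diagonal run ([back_green_horizontal],
    [back_green_diagonal]), while G_m(0) is the sum over j <= m of p(j), resp.
    p(j)^2.  Since p(n) = O(n^{-1/2}), with a lower bound of the same order at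
    even times, the numerators are bounded by the quantities in the two series,
    and G_m(0) is at least of order sqrt m, resp. ln m ([horizontal_estimate],
    [diagonal_estimate]).

    For a_n = n^2 and b_n = 2^n the terms of the two series are O(n^{-3/2}) and
    O(n^2 2^{-n/2}), and both bounds are dominated by telescoping series. *)

(** * Return probabilities of simple random walk on the integers *)

Section simple_walk.
Variable R : realType.

Definition avg1 (f : int -> R) (x : int) : R := (f (x + 1) + f (x - 1)) / 2.

Definition delta1 (x : int) : R := (x == 0)%:R.

(** The probability that simple random walk on the integers started at 0 is at 0
    at time n.  As an iterate of the averaging operator it fits the product
    structure of the planar walk; the binomial formula is derived below. *)
Definition return_prob (n : nat) : R := iter n avg1 delta1 0.

(** A path of n signs with i entries +1 moves x by 2i - n, and there are C(n, i)
    of them; the induction is Pascal's rule. *)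
Lemma iter_avg1 n f x :
  iter n avg1 f x =
  2 ^- n * \sum_(i < n.+1) 'C(n, i)%:R * f (x + (i%:Z *+ 2 - n%:Z)).
Proof.
elim: n x => [|n IH] x.
  by rewrite big_ord_recl big_ord0 /= expr0 invr1 bin0 addr0 !mul1r addr0.
rewrite iterS /avg1 !IH.
set g := fun i : nat => f (x + (i%:Z *+ 2 - n.+1%:Z)).
have -> : \sum_(i < n.+2) 'C(n.+1, i)%:R * f (x + (i%:Z *+ 2 - n.+1%:Z)) =
   \sum_(i < n.+1) 'C(n, i)%:R * g i.+1 + \sum_(i < n.+1) 'C(n, i)%:R * g i.
  have -> : \sum_(i < n.+1) 'C(n, i)%:R * g i =
            \sum_(i < n.+2) 'C(n, i)%:R * g i.
    by rewrite [RHS]big_ord_recr /= bin_small // mul0r addr0.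
  rewrite [LHS]big_ord_recl [X in _ = _ + X]big_ord_recl /= !bin0.
  rewrite [RHS]addrCA -big_split /=.
  congr (_ + _); apply: eq_bigr => i _.
  by rewrite /bump /= add1n binS natrD mulrDl addrC.
rewrite -mulrDr -big_split -[in RHS]big_split /=.
rewrite exprSr invfM -mulrA mulrAC -mulrA.
congr (_ * _); congr (_ * _); apply: eq_bigr => i _.
by rewrite /g; congr (_ * f _ + _ * f _); lia.
Qed.

Lemma return_prob_odd n : odd n -> return_prob n = 0.
Proof.
move=> on; rewrite /return_prob iter_avg1 big1 ?mulr0// => i _.
by rewrite /delta1 (_ : (_ == _) = false) ?mulr0//; lia.
Qed.

Lemma return_prob_even m : return_prob m.*2 = 2 ^- m.*2 * 'C(m.*2, m)%:R.
Proof.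
have hm : (m < m.*2.+1)%N by lia.
rewrite /return_prob iter_avg1 (bigD1 (Ordinal hm))//= big1 ?addr0.
  by rewrite /delta1 (_ : (_ == _) = true) ?mulr1//; lia.
move=> i; rewrite -val_eqE /= => im.
by rewrite /delta1 (_ : (_ == _) = false) ?mulr0//; lia.
Qed.

Lemma return_prob_ge0 n : 0 <= return_prob n.
Proof.
case: (boolP (odd n)) => [/return_prob_odd ->//|].
by move/even_halfK <-; rewrite return_prob_even mulr_ge0// invr_ge0 exprn_ge0.
Qed.

(** This is (m+1)^2 C(2m+2, m+1) = (2m+1)(2m+2) C(2m, m), rescaled by powers
    of 4.  It makes the two Wallis bounds below plain inductions. *)
Lemma return_probSS m :
  return_prob m.+1.*2 * (m.*2.+2)%:R = return_prob m.*2 * (m.*2.+1)%:R.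
Proof.
have e1 := mul_bin_diag m.*2.+2 m.
have e2 := mul_bin_diag m.*2.+1 m.
have e3 : 'C(m.*2.+1, m) = 'C(m.*2.+1, m.+1).
  have h : (m.+1 <= m.*2.+1)%N by lia.
  rewrite -(bin_sub h) (_ : (m.*2.+1 - m.+1 = m)%N) //; lia.
have e : ('C(m.+1.*2, m.+1) * m.*2.+2 = 'C(m.*2, m) * m.*2.+1 * 4)%N.
  rewrite doubleS; move: e1 e2; rewrite /= -e3.
  move: 'C(m.*2.+2, _) 'C(m.*2.+1, _) 'C(m.*2, _) => x y z.
  rewrite -!muln2 => e1 e2.
  have -> : x = (2 * y)%N; last by lia.
  apply/eqP; rewrite -(eqn_pmul2l (ltn0Sn m)); apply/eqP; lia.
rewrite !return_prob_even -!mulrA -!natrM e natrM doubleS !exprSr !invfM.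
by move: (_ ^- _) (_ * _)%:R => u c; field.
Qed.

(** By [return_probSS] this quantity is multiplied at each step by
    (2m+1)(2m+3) / (2m+2)^2 < 1. *)
Lemma return_prob_even_le m : return_prob m.*2 ^+ 2 * (m.*2.+1)%:R <= 1.
Proof.
elim: m => [|m IH]; first by rewrite /return_prob /= /delta1 eqxx expr1n mulr1.
rewrite -(ler_pM2r (x := (m.*2.+2)%:R ^+ 2)) ?exprn_gt0// mulrAC -exprMn.
rewrite return_probSS exprMn mul1r.
apply: le_trans (_ : (m.*2.+1)%:R * (m.+1.*2.+1)%:R <= _).
  rewrite expr2 !mulrA ler_wpM2r// -[leRHS]mul1r ler_wpM2r//.
by rewrite -natrX -natrM ler_nat; lia.
Qed.

(** By [return_probSS] this quantity is multiplied at each step by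
    (2m+3)^2 / (4(m+1)(m+2)) > 1. *)
Lemma return_prob_even_ge m : 1 <= return_prob m.+1.*2 ^+ 2 * (4 * m.+1)%:R.
Proof.
elim: m => [|m IH].
  by rewrite return_prob_even /=; rewrite (_ : 'C(_, _) = 2)//; lra.
rewrite -(ler_pM2r (x := (m.+1.*2.+2)%:R ^+ 2)) ?exprn_gt0// mulrAC -exprMn.
rewrite return_probSS exprMn mul1r.
rewrite -(ler_pM2r (x := (4 * m.+1)%:R)) ?ltr0n//.
apply: (@le_trans _ _ ((m.+1.*2.+1)%:R ^+ 2 * (4 * m.+2)%:R)).
  by rewrite -!natrX -!natrM ler_nat; nia.
rewrite -[leLHS]mul1r [leRHS](_ : _ = return_prob m.+1.*2 ^+ 2 * (4 * m.+1)%:R *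
  (m.+1.*2.+1%:R ^+ 2 * (4 * m.+2)%:R)).
  by rewrite ler_wpM2r// mulr_ge0.
move: (return_prob _) (4 * m.+1)%:R (4 * m.+2)%:R (m.+1.*2.+1)%:R => p x y z.
by ring.
Qed.

Lemma return_prob_le n : return_prob n <= (Num.sqrt n.+1%:R)^-1.
Proof.
case: (boolP (odd n)) => [/return_prob_odd ->|].
  by rewrite invr_ge0 sqrtr_ge0.
move/even_halfK <-; set m := n./2.
rewrite -[leRHS]mul1r ler_pdivlMr ?sqrtr_gt0//.
rewrite -(@expr_le1 _ 2)//; last by rewrite mulr_ge0 ?sqrtr_ge0 ?return_prob_ge0.
by rewrite exprMn sqr_sqrtr// return_prob_even_le.
Qed.

Lemma return_prob_ge m :
  (2 * Num.sqrt m.+1%:R)^-1 <= return_prob m.+1.*2.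
Proof.
rewrite -[leLHS]mul1r ler_pdivrMr ?mulr_gt0 ?sqrtr_gt0//.
rewrite -(@expr_ge1 _ 2)//; last first.
  apply: mulr_ge0; first exact: return_prob_ge0.
  by apply: mulr_ge0 => //; exact: sqrtr_ge0.
move: (return_prob_even_ge m); move: (return_prob _) => p.
by rewrite !exprMn sqr_sqrtr// (_ : 2 ^+ 2 = 4%:R) -?natrX// -natrM.
Qed.

Lemma sum_double_le (F : nat -> R) m n : (forall k, 0 <= F k) ->
  (m.*2 <= n)%N -> \sum_(i < m.+1) F i.*2 <= \sum_(j < n.+1) F j.
Proof.
move=> F0 mn; apply: (@le_trans _ _ (\sum_(j < m.*2.+1) F j)).
  elim: m {mn} => [|m IH]; first by rewrite !big_ord1.
  rewrite doubleS [leRHS]big_ord_recr /= [X in _ <= X + _]big_ord_recr.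
  by rewrite [leLHS]big_ord_recr /= doubleS lerD// -[leLHS]addr0 lerD.
rewrite -(subnKC mn) -addSn big_split_ord /= lerDl.
exact: sumr_ge0.
Qed.

Lemma sqrtS_sub_ge (k : nat) :
  (2 * Num.sqrt k.+1%:R)^-1 <= Num.sqrt k.+1%:R - Num.sqrt k%:R :> R.
Proof.
have s0 : 0 < Num.sqrt k.+1%:R :> R by rewrite sqrtr_gt0.
rewrite -[leLHS]mul1r ler_pdivrMr ?mulr_gt0//.
have := sqr_sqrtr (ler0n R k.+1); have := sqr_sqrtr (ler0n R k).
rewrite -natr1; move: s0; rewrite -natr1.
have := sqrtr_ge0 (k%:R : R).
set s := Num.sqrt (k%:R + 1); set u := Num.sqrt k%:R; move: (k%:R : R) => c.
move=> u0 s0 hu hs; have := sqr_ge0 (s - u); nra.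
Qed.

Lemma sqrtS_sub_le (k : nat) :
  Num.sqrt k.+2%:R - Num.sqrt k.+1%:R <= (2 * Num.sqrt k.+1%:R)^-1 :> R.
Proof.
have s0 : 0 < Num.sqrt k.+1%:R :> R by rewrite sqrtr_gt0.
rewrite -[leRHS]mul1r ler_pdivlMr ?mulr_gt0//.
have := sqr_sqrtr (ler0n R k.+1); have := sqr_sqrtr (ler0n R k.+2).
rewrite -(natr1 k.+1).
have := sqrtr_ge0 (k.+1%:R + 1 : R).
move: s0.
set s := Num.sqrt (k.+1%:R + 1); set u := Num.sqrt k.+1%:R.
move: (k.+1%:R : R) => c.
move=> u0 s0 hu hs; have := sqr_ge0 (s - u); nra.
Qed.

(** Only even times contribute, and at time 2i the return probability is at
    least 1 / (2 sqrt i), which dominates an increment of the square root. *)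
Lemma sum_return_prob_ge n :
  Num.sqrt n%:R / 2 <= \sum_(j < n.+1) return_prob j.
Proof.
have hn : ((n./2).*2 <= n)%N by lia.
apply: le_trans (sum_double_le return_prob_ge0 hn).
apply: (@le_trans _ _ (Num.sqrt (n./2.+1)%:R)).
  rewrite ler_pdivrMr// -[X in _ <= _ * X]ger0_norm//.
  rewrite -[X in _ <= _ * X]sqrtr_sqr -sqrtrM//.
  by rewrite ler_wsqrtr// -natrX -natrM ler_nat; lia.
elim: n./2 => [|m IH].
  by rewrite big_ord1 /= /return_prob /= /delta1 eqxx sqrtr1.
rewrite big_ord_recr /= -lerBlDl.
apply: le_trans (return_prob_ge m); apply: le_trans (sqrtS_sub_le m).
by rewrite lerB.
Qed.

(** The squares at even times are at least 1 / (4i), and the harmonic sum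
    dominates the logarithm.  The term at time 0 absorbs the loss of ln 2 caused
    by halving n. *)
Lemma sum_return_prob_sqr_ge n : (0 < n)%N ->
  ln n%:R / 4 <= \sum_(j < n.+1) return_prob j ^+ 2.
Proof.
move=> n0.
have hn : ((n./2).*2 <= n)%N by lia.
apply: le_trans (sum_double_le (fun k => sqr_ge0 (return_prob k)) hn).
apply: (@le_trans _ _ (1 + ln (n./2.+1)%:R / 4)).
  have : ln n%:R <= ln (2 * n./2.+1)%:R :> R.
    by rewrite ler_ln ?posrE ?ltr0n// ler_nat; lia.
  have : ln 2 < 2 :> R by apply: ln_sublinear.
  by rewrite natrM lnM ?posrE//; lra.
elim: n./2 => [|m IH].
  by rewrite big_ord1 /= /return_prob /= /delta1 eqxx ln1 mul0r addr0 expr1n.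
rewrite big_ord_recr /=; apply: le_trans (lerD IH (lexx _)).
rewrite -addrA lerD2l -lerBlDl -mulrBl -ln_div ?posrE//.
have -> : m.+2%:R / m.+1%:R = 1 + m.+1%:R^-1 :> R.
  by rewrite -(natr1 m.+1) mulrDl mulfV// mul1r.
apply: (@le_trans _ _ (m.+1%:R^-1 / 4)).
  by rewrite ler_pM2r// le_ln1Dx// (lt_le_trans _ (_ : 0 <= _))// invr_ge0.
rewrite -[leLHS]mul1r -invfM ler_pdivrMr ?mulr_gt0// mulrC -natrM mulnC.
rewrite mulrC; exact: return_prob_even_ge.
Qed.

End simple_walk.

(** * Averaging over a step in the plane *)

Section averaging.
Variable R : realType.

Definition stepavg (D : seq Z2) (f : Z2 -> R) (x : Z2) : R :=
  (size D)%:R^-1 * \sum_(v <- D) f (x + v).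

Definition delta2 (x : Z2) : R := (x == 0)%:R.

(** [green D M x] is the expected number of visits to 0 up to time M of the walk
    with independent steps uniform on D, started at x. *)
Definition green (D : seq Z2) (M : nat) (x : Z2) : R :=
  \sum_(j < M.+1) iter j (stepavg D) delta2 x.

Lemma stepavg_sum D n (f : 'I_n -> Z2 -> R) :
  stepavg D (fun x => \sum_(j < n) f j x) =
  (fun x => \sum_(j < n) stepavg D (f j) x).
Proof.
by apply/funext => x; rewrite /stepavg exchange_big mulr_sumr.
Qed.

Lemma stepavg_ge0 D f : (forall x, 0 <= f x) -> forall x, 0 <= stepavg D f x.
Proof. by move=> f0 x; rewrite mulr_ge0 ?invr_ge0 ?sumr_ge0. Qed.

Lemma stepavgZr D f c x : stepavg D (fun y => f y * c) x = stepavg D f x * c.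
Proof. by rewrite /stepavg -mulr_suml mulrA. Qed.

Lemma iter_stepavg_ge0 D j x : 0 <= iter j (stepavg D) delta2 x.
Proof. by elim: j x => [|j IH] x; [exact: ler0n|exact: stepavg_ge0]. Qed.

(** First-step decomposition, the recursion on which the hitting estimate
    rests. *)
Lemma greenS D M x : green D M.+1 x = delta2 x + stepavg D (green D M) x.
Proof. by rewrite /green big_ord_recl stepavg_sum. Qed.

Lemma green_ge0 D M x : 0 <= green D M x.
Proof. by apply: sumr_ge0 => j _; exact: iter_stepavg_ge0. Qed.

Lemma green_nondecreasing D m n x : (m <= n)%N -> green D m x <= green D n x.
Proof.
move=> mn; rewrite /green -(subnKC mn) -addSn big_split_ord /= lerDl.
by apply: sumr_ge0 => j _; exact: (iter_stepavg_ge0 D (m.+1 + j)).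
Qed.

Lemma green_gt0 D M : 0 < green D M 0.
Proof.
apply: (@lt_le_trans _ _ (green D 0 0)); last exact: green_nondecreasing.
by rewrite /green big_ord1 /= /delta2 eqxx.
Qed.

(** [back D t f x] is the expectation of f at time t for the walk started at x
    whose k-th step is uniform on [D k]; it is computed backwards in time, the
    last step being averaged first. *)
Fixpoint back (D : nat -> seq Z2) (t : nat) (f : Z2 -> R) : Z2 -> R :=
  if t is t'.+1 then back D t' (stepavg (D t') f) else f.

Lemma back_sum D t n (f : 'I_n -> Z2 -> R) :
  back D t (fun x => \sum_(j < n) f j x) =
  (fun x => \sum_(j < n) back D t (f j) x).
Proof. by elim: t f => [//|t IH] f /=; rewrite stepavg_sum IH. Qed.

Lemma backZr D t f c x : back D t (fun y => f y * c) x = back D t f x * c.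
Proof.
elim: t f x => [//|t IH] f x /=; rewrite -IH; congr (back _ _ _ _).
by apply/funext => y; exact: stepavgZr.
Qed.

Definition tensor (f g : int -> R) (x : Z2) : R := f x.1 * g x.2.

Lemma delta2_tensor : delta2 = tensor (@delta1 R) (@delta1 R).
Proof.
apply/funext => -[x y].
by rewrite /delta2 /tensor /delta1 -natrM mulnb xpair_eqE.
Qed.

Lemma stepavg_diagonal f g :
  stepavg diagonal_vectors (tensor f g) = tensor (avg1 f) (avg1 g).
Proof.
apply/funext => -[x y]; rewrite /stepavg /diagonal_vectors !big_cons big_nil.
by rewrite /tensor /avg1 /=; field.
Qed.

Lemma stepavg_horizontal f g :
  stepavg horizontal_vectors (tensor f g) = tensor (avg1 f) g.
Proof.
apply/funext => -[x y]; rewrite /stepavg /horizontal_vectors !big_cons big_nil.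
by rewrite /tensor /avg1 /= !addr0; field.
Qed.

Lemma iter_stepavg_diagonal j f g :
  iter j (stepavg diagonal_vectors) (tensor f g) =
  tensor (iter j (@avg1 R) f) (iter j (@avg1 R) g).
Proof. by elim: j => [//|j IH]; rewrite !iterS IH stepavg_diagonal. Qed.

Lemma iter_stepavg_horizontal j f g :
  iter j (stepavg horizontal_vectors) (tensor f g) =
  tensor (iter j (@avg1 R) f) g.
Proof. by elim: j => [//|j IH]; rewrite !iterS IH stepavg_horizontal. Qed.

Definition walk_law (diag : nat -> bool) (k : nat) : seq Z2 :=
  if diag k then diagonal_vectors else horizontal_vectors.

Lemma back_tensor (diag : nat -> bool) t f g :
  back (walk_law diag) t (tensor f g) =
  tensor (iter t (@avg1 R) f) (iter (\sum_(i < t) diag i) (@avg1 R) g).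
Proof.
elim: t f g => [|t IH] f g; first by rewrite big_ord0.
rewrite big_ord_recr /= /walk_law; case: (diag t).
  by rewrite stepavg_diagonal IH -!iterSr addn1.
by rewrite stepavg_horizontal IH -!iterSr addn0.
Qed.

Lemma back_green_diagonal (diag : nat -> bool) t M :
  back (walk_law diag) t (green diagonal_vectors M) 0 =
  \sum_(j < M.+1) return_prob R (t + j) *
                  return_prob R (\sum_(i < t) diag i + j).
Proof.
rewrite /green back_sum; apply: eq_bigr => j _.
by rewrite delta2_tensor iter_stepavg_diagonal back_tensor /tensor /= -!iterD.
Qed.

Lemma back_green_horizontal (diag : nat -> bool) t M :
  back (walk_law diag) t (green horizontal_vectors M) 0 =
  \sum_(j < M.+1) return_prob R (t + j) *
                  return_prob R (\sum_(i < t) diag i).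
Proof.
rewrite /green back_sum; apply: eq_bigr => j _.
by rewrite delta2_tensor iter_stepavg_horizontal back_tensor /tensor /= -!iterD.
Qed.

Lemma green_diagonal0 M :
  green diagonal_vectors M 0 = \sum_(j < M.+1) return_prob R j ^+ 2.
Proof.
apply: eq_bigr => j _.
by rewrite delta2_tensor iter_stepavg_diagonal /tensor /= expr2.
Qed.

Lemma green_horizontal0 M :
  green horizontal_vectors M 0 = \sum_(j < M.+1) return_prob R j.
Proof.
apply: eq_bigr => j _.
by rewrite delta2_tensor iter_stepavg_horizontal /tensor /= /delta1 eqxx mulr1.
Qed.

End averaging.

(** * Hitting the origin during a run of identically distributed steps *)

Section real_probability.
Context d (T : measurableType d) (R : realType) (P : probability T R).

(** Real-valued probabilities, so that the inductions on runs can divide by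
    Green functions in a field. *)
Definition pr (A : set T) : R := fine (P A).

Lemma prE A : measurable A -> P A = (pr A)%:E.
Proof. by move=> mA; rewrite /pr fineK// fin_num_measure. Qed.

Lemma pr_ge0 A : 0 <= pr A.
Proof. exact: fine_ge0. Qed.

Lemma pr_le A B : measurable A -> measurable B -> A `<=` B -> pr A <= pr B.
Proof.
by move=> mA mB AB; rewrite -lee_fin -!prE// le_measure ?inE.
Qed.

Lemma pr_setU_le A B : measurable A -> measurable B ->
  pr (A `|` B) <= pr A + pr B.
Proof.
move=> mA mB; rewrite -lee_fin EFinD -!prE//; first exact: measureU2.
exact: measurableU.
Qed.

(** A finite union bound up to a null set; here the null set will be the event
    that a step leaves its finite support. *)
Lemma pr_cover_le (I : Type) (s : seq I) (A : I -> set T) (N X : set T) :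
  (forall i, measurable (A i)) -> measurable N -> measurable X ->
  pr N = 0 ->
  (forall w, X w -> N w \/ List.Exists (fun i => A i w) s) ->
  pr X <= \sum_(i <- s) pr (A i).
Proof.
move=> mA mN + N0; elim: s X => [|i s IH] X mX XA.
  rewrite big_nil -N0; apply: pr_le => // w /XA[//|h]; inversion h.
rewrite big_cons; apply: (@le_trans _ _ (pr (A i) + pr (X `\` A i))).
  apply: le_trans (pr_setU_le _ _) => //; last exact: measurableD.
  apply: pr_le => //; first by apply: measurableU => //; exact: measurableD.
  by move=> w Xw; have [Aw|Aw] := pselect (A i w); [left|right].
rewrite lerD2l; apply: IH; first exact: measurableD.
move=> w [/XA[Nw _|h Aw]]; first by left.
by right; inversion h.
Qed.

End real_probability.

Section walk.
Context d (T : measurableType d) (R : realType) (P : probability T R).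
Variables (S : nat -> T -> Z2) (D : nat -> seq Z2).
Hypothesis S_meas : forall k, random_vector (S k).
Hypothesis S_start : forall w, S 0%N w = 0.
Hypothesis S_indep : mutually_independent P (steps S).
Hypothesis S_law : forall k, uniform_on P (D k) (steps S k).

Lemma countable_Z2 : countable [set: Z2].
Proof. exact: countableP. Qed.

Lemma measurable_step k : random_vector (steps S k).
Proof.
move=> E; have -> : steps S k @^-1` E =
    \bigcup_(x : Z2) (S k @^-1` [set x] `&` S k.+1 @^-1` [set y | E (y - x)]).
  by apply/seteqP; split=> [w Ew|w [x _ [<- //]]]; exists (S k w).
apply: countable_bigcupT_measurable => [|x]; first exact: countable_Z2.
by apply: measurableI; exact: S_meas.
Qed.

(** An intersection over [iota 0 (size v)], the form to which the product rule
    of [mutually_independent] applies directly. *)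
Definition cylinder (v : seq Z2) : set T :=
  \bigcap_(i in [set` iota 0 (size v)]) (steps S i @^-1` [set nth 0 v i]).

Lemma cylinderP v w :
  cylinder v w <-> forall i, (i < size v)%N -> steps S i w = nth 0 v i.
Proof.
split=> h i; first by move=> iv; apply: h; rewrite /= mem_iota.
by rewrite /= mem_iota => /h.
Qed.

Lemma measurable_cylinder v : measurable (cylinder v).
Proof. by apply: bigcap_measurableType => i _; exact: measurable_step. Qed.

Lemma cylinder_rcons v u w :
  cylinder (rcons v u) w <-> cylinder v w /\ steps S (size v) w = u.
Proof.
rewrite !cylinderP size_rcons; split=> [h|[h1 h2] i].
  split=> [i iv|]; last by rewrite h// nth_rcons ltnn eqxx.
  by rewrite h ?nth_rcons ?iv// ltnW.
rewrite ltnS leq_eqVlt nth_rcons => /predU1P[->|iv]; first by rewrite ltnn eqxx.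
by rewrite iv h1.
Qed.

Lemma cylinder_end v w : cylinder v w -> S (size v) w = \sum_(u <- v) u.
Proof.
elim/last_ind: v => [|v u IH]; first by rewrite big_nil S_start.
move=> /cylinder_rcons[/IH e h]; rewrite size_rcons big_rcons /= -e -h.
by rewrite /steps addrC subrK.
Qed.

Lemma pr_cylinder_rcons v u :
  pr P (cylinder (rcons v u)) =
  pr P (cylinder v) * pr P (steps S (size v) @^-1` [set u]).
Proof.
apply: EFin_inj; rewrite EFinM -!prE; [|exact: measurable_step|
  exact: measurable_cylinder|exact: measurable_cylinder].
rewrite /cylinder !S_indep ?iota_uniq//.
rewrite size_rcons -addn1 iotaD cats1 big_rcons /=.
rewrite add0n nth_rcons ltnn eqxx; congr (_ * _)%E.
by apply: eq_big_seq => i; rewrite mem_iota /= add0n => iv; rewrite nth_rcons iv.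
Qed.

(** The law of a step is prescribed on points only, so the complement of the
    support is null because Z^2 is countable. *)
Lemma pr_step_notin k : pr P (steps S k @^-1` [set u | u \notin D k]) = 0.
Proof.
(* the points outside the support, enumerated by their codes *)
pose F n := if unpickle n is Some u then
  if u \notin D k then steps S k @^-1` [set u] else set0 else set0.
have F0 n : P.-negligible (F n).
  rewrite /F; case: (unpickle n) => [u|]; last exact: negligible_set0.
  case: ifPn => [uD|_]; last exact: negligible_set0.
  apply/negligibleP; first exact: measurable_step.
  by have := S_law k u; rewrite (negbTE uD).
have mE : measurable (steps S k @^-1` [set u | u \notin D k]).
  exact: measurable_step.
rewrite /pr (measure_negligible mE)//.
apply: negligibleS (negligible_bigcup F0) => w /= wD.
exists (pickle (steps S k w)); first exact: I.
by rewrite /F pickleK wD.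
Qed.

(** Markov property in the form needed below: a bound on the conditional
    probability of F given the first k+1 steps, which depends only on the
    position, is turned into one given the first k steps by averaging over the
    next step. *)
Lemma cylinder_average (F : set T) (g : Z2 -> R) k : measurable F ->
  (forall v, size v = k.+1 ->
    pr P (cylinder v `&` F) <= pr P (cylinder v) * g (\sum_(u <- v) u)) ->
  forall v, size v = k ->
    pr P (cylinder v `&` F) <=
    pr P (cylinder v) * stepavg (D k) g (\sum_(u <- v) u).
Proof.
move=> mF hF v vk; rewrite /stepavg mulrA mulr_sumr.
have mC u : measurable (cylinder (rcons v u) `&` F).
  by apply: measurableI => //; exact: measurable_cylinder.
have mX : measurable (cylinder v `&` F).
  by apply: measurableI => //; exact: measurable_cylinder.
have mN : measurable (steps S k @^-1` [set u | u \notin D k]).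
  exact: measurable_step.
apply: le_trans (pr_cover_le (s := D k) mC mN mX (pr_step_notin k) _) _.
  move=> w [vw Fw]; have [|uD] := boolP (steps S k w \in D k); last by left.
  move=> uD; right; elim: (D k) uD => [//|u s IH].
  rewrite in_cons => /predU1P[<-|/IH h]; last by right.
  by left; split=> //; apply/cylinder_rcons; rewrite vk.
rewrite [leLHS]big_seq [leRHS]big_seq; apply: ler_sum => u uD.
apply: le_trans (hF _ _) _; first by rewrite size_rcons vk.
rewrite big_rcons /= pr_cylinder_rcons vk.
by rewrite [pr P (steps S k @^-1` _)]/pr S_law uD.
Qed.

Lemma pr_le_back (F : set T) (g : Z2 -> R) t : measurable F ->
  (forall v, size v = t ->
    pr P (cylinder v `&` F) <= pr P (cylinder v) * g (\sum_(u <- v) u)) ->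
  pr P F <= back D t g 0.
Proof.
move=> mF; elim: t g => [|t IH] g hg.
  have := hg [::] erefl; rewrite big_nil.
  have -> : cylinder [::] = setT by rewrite /cylinder set_nil bigcap_set0.
  by rewrite setTI /pr probability_setT /= mul1r.
by apply: IH => v vt; exact: cylinder_average.
Qed.

Definition zero_between (k l : nat) : set T :=
  \bigcup_(j in [set j | (k <= j <= l)%N]) (S j @^-1` [set 0]).

Lemma measurable_zero_between k l : measurable (zero_between k l).
Proof. by apply: bigcup_measurable => j _; exact: S_meas. Qed.

(** Given the past up to time k, the probability of hitting 0 in a run of m
    steps times the mean number of visits in M - m steps from 0 is at most the
    mean number of visits in M steps from the current position: a hit at time
    k + i leaves M - i >= M - m steps.  In the induction on m, either the walk is
    at 0 already and the bound is monotonicity of the Green function in time, or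
    the first step of the run can be averaged out by [greenS]. *)
Lemma cylinder_zero_le_green (D0 : seq Z2) k m M : (m <= M)%N ->
  (forall j, (k <= j < k + m)%N -> D j = D0) ->
  forall v, size v = k ->
  pr P (cylinder v `&` zero_between k (k + m)) <=
  pr P (cylinder v) * (green R D0 M (\sum_(u <- v) u) / green R D0 (M - m) 0).
Proof.
have mCZ v k' l : measurable (cylinder v `&` zero_between k' l).
  by apply: measurableI; [exact: measurable_cylinder|exact: measurable_zero_between].
elim: m M k => [|m IH] M k mM hD v vk.
- have [x0|x0] := eqVneq (\sum_(u <- v) u) 0.
    rewrite x0 subn0 mulfV ?gt_eqF ?green_gt0// mulr1.
    by apply: pr_le => [||w []//]; first exact: mCZ; exact: measurable_cylinder.
  rewrite (_ : _ `&` _ = set0); last first.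
    apply/seteqP; split=> [w [/cylinder_end]|//]; rewrite vk => e [j /=].
    rewrite addn0 -eqn_leq => /eqP <-; rewrite e => h; by rewrite h eqxx in x0.
  by rewrite /pr measure0 /= mulr_ge0 ?pr_ge0// divr_ge0// green_ge0.
- have [x0|x0] := eqVneq (\sum_(u <- v) u) 0.
    rewrite x0; apply: (@le_trans _ _ (pr P (cylinder v))).
      by apply: pr_le => [||w []//]; first exact: mCZ; exact: measurable_cylinder.
    rewrite ler_peMr ?pr_ge0// ler_pdivlMr ?green_gt0// mul1r.
    by apply: green_nondecreasing; exact: leq_subr.
  case: M mM => [//|M]; rewrite ltnS => mM.
  have -> : cylinder v `&` zero_between k (k + m.+1) =
            cylinder v `&` zero_between k.+1 (k.+1 + m).
    apply/seteqP; split=> w [vw [j /= kj Sj]]; split=> //; exists j => //=;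
      last by lia.
    (* the walk is not at 0 at time k, so the zero comes later *)
    rewrite addSnnS; case/andP: kj => kj ->; rewrite andbT ltn_neqAle kj andbT.
    apply: contraNneq x0 => kj'.
    move: (cylinder_end vw); rewrite vk kj' Sj => <-.
    exact/eqP.
  rewrite subSS.
  apply: le_trans (@cylinder_average _
    (fun x => green R D0 M x / green R D0 (M - m) 0) k _
    (IH M k.+1 mM _) v vk) _.
  + exact: measurable_zero_between.
  + by move=> j hj; apply: hD; lia.
  rewrite stepavgZr greenS hD; last by lia.
  by rewrite ler_wpM2l ?pr_ge0// ler_wpM2r ?invr_ge0 ?green_ge0// lerDr ler0n.
Qed.

(** Taking M = 2m leaves m steps after any hit in the run. *)
Lemma pr_zero_between_le (D0 : seq Z2) t m :
  (forall j, (t <= j < t + m)%N -> D j = D0) ->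
  pr P (zero_between t (t + m)) <=
  back D t (green R D0 m.*2) 0 / green R D0 m 0.
Proof.
move=> hD; have mm : (m <= m.*2)%N by lia.
rewrite -backZr; apply: pr_le_back; first exact: measurable_zero_between.
move=> v vt; apply: le_trans (cylinder_zero_le_green mm hD vt) _.
by rewrite -addnn addnK.
Qed.

End walk.

(** * Alternating runs *)

Lemma psum0 (f : nat -> nat) : psum f 0 = 0%N.
Proof. by rewrite /psum big_geq. Qed.

Lemma psumS (f : nat -> nat) n : psum f n.+1 = (psum f n + f n.+1)%N.
Proof. by rewrite /psum big_nat_recr. Qed.

Lemma psum_nondecreasing (f : nat -> nat) m n :
  (m <= n)%N -> (psum f m <= psum f n)%N.
Proof.
move=> mn; rewrite -(subnK mn); elim: (n - m)%N => [//|k IH].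
by rewrite addSn psumS (leq_trans IH)// leq_addr.
Qed.

Lemma increasing_cover (c : nat -> nat) k : (forall n, (c n < c n.+1)%N) ->
  (c 0%N <= k)%N -> exists n, (c n <= k < c n.+1)%N.
Proof.
move=> cS; elim: k => [|k IH] ck.
  by exists 0%N; rewrite ck; apply: leq_ltn_trans (cS _).
have [e|ne] := eqVneq (c 0%N) k.+1.
  by exists 0%N; rewrite ck -e cS.
have [|n /andP[cn nk]] := IH; first by lia.
have [h|h] := ltnP k.+1 (c n.+1); first by exists n; rewrite h ltnW.
by exists n.+1; rewrite h /=; apply: leq_ltn_trans (cS _).
Qed.

Lemma sum_const_run (f : nat -> bool) (c : bool) t m :
  (forall i, (t <= i < t + m)%N -> f i = c) ->
  (\sum_(i < t + m) f i = \sum_(i < t) f i + m * c)%N.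
Proof.
move=> fc; rewrite big_split_ord /=; congr addn.
rewrite (eq_bigr (fun _ => nat_of_bool c)) ?sum_nat_const ?card_ord// => i _.
by rewrite fc//= leq_addr ltn_add2l ltn_ord.
Qed.

Section blocks.
Variables (a b : nat -> nat).
Hypothesis apos : positive_seq a.
Local Notation A := (psum a).
Local Notation B := (psum b).

Lemma psum_gt0 n : (0 < n)%N -> (0 < psum a n)%N.
Proof. by case: n => [//|n] _; rewrite psumS addn_gt0 apos ?orbT. Qed.

Lemma diagonal_or_horizontal_time k :
  diagonal_time a b k \/ horizontal_time a b k.
Proof.
have [||n] := @increasing_cover (fun n => A n + B n)%N k.
- by move=> n; rewrite !psumS; have := @apos n.+1 isT; lia.
- by rewrite !psum0.
move=> /andP[h1 h2]; have [h|h] := ltnP k (A n.+1 + B n).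
  by left; exists n; rewrite h1.
by right; exists n; rewrite h h2.
Qed.

Lemma diagonal_horizontal_exclusive k :
  diagonal_time a b k -> horizontal_time a b k -> False.
Proof.
move=> [n hn] [m hm].
have [nm|mn] := leqP n m.
  have := @psum_nondecreasing a n.+1 m.+1 nm.
  have := @psum_nondecreasing b n m nm.
  by lia.
have := @psum_nondecreasing a m.+1 n mn; have := @psum_nondecreasing b m.+1 n mn.
by lia.
Qed.

Definition diagonalb (k : nat) : bool := `[< diagonal_time a b k >].

Lemma diagonal_run n i : (A n + B n <= i < A n + B n + a n.+1)%N ->
  diagonalb i = true.
Proof. by move=> h; apply/asboolP; exists n; rewrite psumS; lia. Qed.

Lemma horizontal_run n i : (A n.+1 + B n <= i < A n.+1 + B n + b n.+1)%N ->
  diagonalb i = false.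
Proof.
move=> h; apply/asboolP => hd; apply: (diagonal_horizontal_exclusive hd).
by exists n; rewrite (psumS b); lia.
Qed.

(** The second coordinate moves at diagonal steps only.  By this lemma and the
    next one it has made the same number of steps at both ends of a horizontal
    run. *)
Lemma count_diagonal_horizontal_start n :
  (\sum_(i < A n.+1 + B n) diagonalb i = A n.+1)%N.
Proof.
elim: n => [|n IH].
  have hd : (A 1 + B 0 = 0 + a 1)%N by rewrite psumS !psum0 addn0.
  rewrite hd (@sum_const_run _ true); last first.
    by move=> i hi; apply: (@diagonal_run 0); rewrite !psum0.
  by rewrite big_ord0 muln1 psumS psum0.
have hd : (A n.+2 + B n.+1 = A n.+1 + B n + b n.+1 + a n.+2)%N.
  by rewrite !psumS; lia.
rewrite hd (@sum_const_run _ true); last first.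
  by move=> i hi; apply: (@diagonal_run n.+1); rewrite (psumS b); lia.
rewrite (@sum_const_run _ false); last by move=> i hi; apply: (@horizontal_run n).
by rewrite IH muln0 muln1 addn0 -psumS.
Qed.

Lemma count_diagonal_diagonal_start n :
  (\sum_(i < A n.+1 + B n.+1) diagonalb i = A n.+1)%N.
Proof.
rewrite (psumS b) addnA (@sum_const_run _ false).
  by rewrite count_diagonal_horizontal_start muln0 addn0.
exact: horizontal_run.
Qed.

End blocks.

(** * Numerical bounds for a single run *)

Section estimates.
Variable R : realType.
Local Notation rp := (return_prob R).

Lemma invsqrt_le (m n : nat) : (0 < m)%N -> (m <= n)%N ->
  (Num.sqrt n%:R)^-1 <= (Num.sqrt m%:R)^-1 :> R.
Proof.
move=> m0 mn; rewrite lef_pV2 ?posrE ?sqrtr_gt0 ?ltr0n ?(leq_trans m0)//.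
by rewrite ler_wsqrtr// ler_nat.
Qed.

(** p(k) is at most (k+1)^{-1/2}, hence at most twice an increment of the square
    root, and the bound telescopes. *)
Lemma sum_return_prob_le t m :
  \sum_(j < m) rp (t + j) <= 2 * (Num.sqrt (t + m)%:R - Num.sqrt t%:R).
Proof.
elim: m => [|m IH]; first by rewrite big_ord0 addn0 subrr mulr0.
rewrite big_ord_recr /=; have := return_prob_le R (t + m).
have := sqrtS_sub_ge R (t + m); rewrite invfM addnS; lra.
Qed.

(** Concavity of the square root, as 2b+1 <= 3b. *)
Lemma sqrt_increment_triple t b : (0 < b)%N ->
  Num.sqrt (t + b.*2.+1)%:R - Num.sqrt t%:R <=
  3 * (Num.sqrt (t + b)%:R - Num.sqrt t%:R) :> R.
Proof.
move=> b0; rewrite lerBlDr.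
have xy : Num.sqrt t%:R <= Num.sqrt (t + b)%:R :> R.
  by rewrite ler_wsqrtr// ler_nat leq_addr.
have hx := sqr_sqrtr (ler0n R t); have hy := sqr_sqrtr (ler0n R (t + b)).
have x0 := sqrtr_ge0 (t%:R : R).
have hz : (t + b.*2.+1)%:R <= 3 * (t + b)%:R - 2 * t%:R :> R.
  by rewrite lerBrDr -!natrM -natrD ler_nat; lia.
move: xy hx hy x0 hz; set x := Num.sqrt t%:R; set y := Num.sqrt (t + b)%:R.
move=> xy hx hy x0 hz.
have h0 : 0 <= 3 * (y - x) + x by lra.
rewrite -[leRHS]ger0_norm// -sqrtr_sqr ler_wsqrtr// (le_trans hz)// -hx -hy.
have := sqr_ge0 (y - x); nra.
Qed.

(** Here 12 = 2 * 3 * 2: the factor 2 of [sum_return_prob_le], the factor 3 of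
    [sqrt_increment_triple] and the factor 2 from the bound sqrt b / 2 on the
    Green function. *)
Lemma horizontal_estimate (t b A : nat) : (0 < b)%N -> (0 < A)%N ->
  (\sum_(j < b.*2.+1) rp (t + j) * rp A) / (\sum_(j < b.+1) rp j) <=
  12 * ((Num.sqrt A%:R)^-1 *
        ((Num.sqrt (t + b)%:R - Num.sqrt t%:R) / Num.sqrt b%:R)).
Proof.
move=> b0 A0; rewrite -mulr_suml.
have sb : 0 < Num.sqrt b%:R :> R by rewrite sqrtr_gt0 ltr0n.
have G := sum_return_prob_ge R b.
have hA : rp A <= (Num.sqrt A%:R)^-1.
  by apply: le_trans (return_prob_le R A) (invsqrt_le _ _).
have hs : \sum_(j < b.*2.+1) rp (t + j) <=
    6 * (Num.sqrt (t + b)%:R - Num.sqrt t%:R).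
  apply: le_trans (sum_return_prob_le _ _) _.
  by have := sqrt_increment_triple t b0; lra.
have hs0 : 0 <= \sum_(j < b.*2.+1) rp (t + j).
  by apply: sumr_ge0 => j _; exact: return_prob_ge0.
have hG : (\sum_(j < b.+1) rp j)^-1 <= (Num.sqrt b%:R / 2)^-1.
  rewrite lef_pV2 ?posrE ?divr_gt0//.
  by apply: lt_le_trans G; rewrite divr_gt0.
apply: (@le_trans _ _ (6 * (Num.sqrt (t + b)%:R - Num.sqrt t%:R) *
   (Num.sqrt A%:R)^-1 * (Num.sqrt b%:R / 2)^-1)).
  apply: ler_pM => //; last by apply: ler_pM => //; exact: return_prob_ge0.
    by rewrite mulr_ge0// return_prob_ge0.
  by rewrite invr_ge0 sumr_ge0// => j _; exact: return_prob_ge0.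
rewrite invfM invrK.
by move: (_ - _) (_ ^-1) (_ ^-1) => x y z; lra.
Qed.

Lemma sum_nonincreasing_triple (f : nat -> R) a : (0 < a)%N ->
  (forall j, 0 <= f j) -> (forall i j, (i <= j)%N -> f j <= f i) ->
  \sum_(j < a.*2.+1) f j <= 3 * \sum_(j < a) f j.
Proof.
move=> a0 f0 fd; rewrite big_ord_recr /= -addnn big_split_ord /=.
have h1 : \sum_(j < a) f (a + j)%N <= \sum_(j < a) f j.
  by apply: ler_sum => j _; apply: fd; rewrite leq_addl.
have h2 : f (a + a)%N <= \sum_(j < a) f j.
  case: a a0 {h1} => [//|a] _; rewrite big_ord_recl.
  apply: (le_trans (fd 0%N _ _)) => //.
  by rewrite lerDl sumr_ge0.
lra.
Qed.

(** Here 12 = 3 * 4: doubling the length of the run costs a factor 3 because the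
    summands decrease, and the Green function is at least ln a / 4.  Since
    p(n) <= (n+1)^{-1/2}, the j-th summand on the left can be compared with the
    (j+1)-st on the right, and the visit at j = 0 needs no separate bound. *)
Lemma diagonal_estimate (t a A : nat) : (1 < a)%N ->
  (\sum_(j < a.*2.+1) rp (t + j) * rp (A + j)) / (\sum_(j < a.+1) rp j ^+ 2) <=
  12 * ((ln a%:R)^-1 *
        \sum_(1 <= j < a.+1) (t + j)%:R `^ (- 2^-1) * (A + j)%:R `^ (- 2^-1)).
Proof.
move=> a1; have a0 : (0 < a)%N by exact: ltnW.
pose f j : R := (Num.sqrt (t + j.+1)%:R)^-1 * (Num.sqrt (A + j.+1)%:R)^-1.
have f0 j : 0 <= f j by rewrite mulr_ge0// invr_ge0 sqrtr_ge0.
have -> : \sum_(1 <= j < a.+1) (t + j)%:R `^ (- 2^-1) * (A + j)%:R `^ (- 2^-1) =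
    \sum_(j < a) f j.
  rewrite big_add1 big_mkord; apply: eq_bigr => j _.
  by rewrite !powRN !powR12_sqrt.
have hs : \sum_(j < a.*2.+1) rp (t + j) * rp (A + j) <= 3 * \sum_(j < a) f j.
  apply: le_trans (sum_nonincreasing_triple a0 f0 _); last first.
    by move=> i j ij; apply: ler_pM; rewrite ?invr_ge0 ?sqrtr_ge0//;
      apply: invsqrt_le; lia.
  apply: ler_sum => j _; rewrite /f !addnS.
  by apply: ler_pM; rewrite ?return_prob_ge0 ?return_prob_le.
have l0 : 0 < ln a%:R :> R by rewrite ln_gt0// ltr1n.
have G := sum_return_prob_sqr_ge R a0.
have hG : (\sum_(j < a.+1) rp j ^+ 2)^-1 <= (ln a%:R / 4)^-1.
  rewrite lef_pV2 ?posrE ?divr_gt0//.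
  by apply: lt_le_trans G; rewrite divr_gt0.
apply: (@le_trans _ _ (3 * (\sum_(j < a) f j) * (ln a%:R / 4)^-1)).
  apply: ler_pM => //.
    by apply: sumr_ge0 => j _; rewrite mulr_ge0 ?return_prob_ge0.
  by rewrite invr_ge0 sumr_ge0// => j _; exact: sqr_ge0.
rewrite invfM invrK.
by move: (_ ^-1) (\sum_(_ < _) _) => x y; lra.
Qed.

End estimates.

(** * Transience *)

Section series_terms.
Variables (R : realType) (a b : nat -> nat).
Local Notation A := (psum a).
Local Notation B := (psum b).

Definition horizontal_term (n : nat) : \bar R :=
  ((Num.sqrt (A n)%:R)^-1 *
     ((Num.sqrt (A n + B n)%:R - Num.sqrt (A n + B n.-1)%:R)
      / Num.sqrt (b n)%:R))%:E.

Definition diagonal_term (n : nat) : \bar R :=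
  ((ln (a n.+1)%:R)%:E^-1 *
     (\sum_(1 <= j < (a n.+1).+1)
        (B n + A n + j)%:R `^ (- 2^-1) * (A n + j)%:R `^ (- 2^-1))%:E)%E.

Lemma horizontal_term_ge0 n : (0 <= horizontal_term n)%E.
Proof.
rewrite lee_fin mulr_ge0 ?invr_ge0 ?sqrtr_ge0// divr_ge0 ?sqrtr_ge0// subr_ge0.
by rewrite ler_wsqrtr// ler_nat leq_add2l psum_nondecreasing// leq_pred.
Qed.

Lemma diagonal_term_ge0 n : (0 <= diagonal_term n)%E.
Proof.
rewrite mule_ge0 ?inve_ge0 ?lee_fin//; last first.
  by apply: sumr_ge0 => j _; rewrite mulr_ge0 ?powR_ge0.
case: (a n.+1) => [|m]; first by rewrite ln0.
by rewrite ln_ge0// ler1n.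
Qed.

End series_terms.

Section transience.
Context d (T : measurableType d) (R : realType) (P : probability T R).
Variables (a b : nat -> nat) (S : nat -> T -> Z2).
Hypotheses (apos : positive_seq a) (bpos : positive_seq b).
Hypothesis walkS : diag_horiz_walk P a b S.
Local Notation A := (psum a).
Local Notation B := (psum b).

Lemma step_law k : uniform_on P (walk_law (diagonalb a b) k) (steps S k).
Proof.
rewrite /walk_law; case: ifPn => [/asboolP|/asboolPn nd].
  exact: (walk_diagonal walkS).
by apply: (walk_horizontal walkS); case: (diagonal_or_horizontal_time b apos k).
Qed.

Lemma walk_zero_between_le (D0 : seq Z2) t m :
  (forall j, (t <= j < t + m)%N -> walk_law (diagonalb a b) j = D0) ->
  pr P (zero_between S t (t + m)) <=
  back (walk_law (diagonalb a b)) t (green R D0 m.*2) 0 / green R D0 m 0.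
Proof.
exact: (pr_zero_between_le (walk_random_vector walkS) (walk_start walkS)
  (walk_independent walkS) step_law).
Qed.

Lemma horizontal_run_bound n :
  (P (zero_between S (A n.+1 + B n) (A n.+1 + B n.+1))
     <= 12%:E * horizontal_term R a b n.+1)%E.
Proof.
have mZ k l := measurable_zero_between (walk_random_vector walkS) k l.
rewrite (prE P (mZ _ _)) -EFinM lee_fin (psumS b) addnA.
apply: le_trans (walk_zero_between_le (D0 := horizontal_vectors) _) _.
  by move=> j hj; rewrite /walk_law (horizontal_run hj).
rewrite back_green_horizontal green_horizontal0 count_diagonal_horizontal_start.
by apply: horizontal_estimate; [exact: bpos|exact: psum_gt0].
Qed.

(** When the run has length 1 the factor 1 / ln 1 makes the right-hand side
    infinite. *)
Lemma diagonal_run_bound n :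
  (P (zero_between S (A n.+1 + B n.+1) (A n.+2 + B n.+1))
     <= 12%:E * diagonal_term R a b n.+1)%E.
Proof.
have mZ k l := measurable_zero_between (walk_random_vector walkS) k l.
have := apos (ltn0Sn n.+1); rewrite leq_eqVlt => /predU1P[a1|a1].
  rewrite /diagonal_term -a1 ln1 inver eqxx big_nat1 gt0_mulye.
    by rewrite gt0_muley ?lte_fin// leey.
  by rewrite lte_fin mulr_gt0// powR_gt0// ltr0n addn1.
have l0 : ln (a n.+2)%:R != 0 :> R by rewrite gt_eqF// ln_gt0// ltr1n.
rewrite /diagonal_term inver (negbTE l0) -!EFinM.
have -> : (A n.+2 + B n.+1 = A n.+1 + B n.+1 + a n.+2)%N by rewrite psumS; lia.
rewrite (prE P (mZ _ _)) lee_fin.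
apply: le_trans (walk_zero_between_le (D0 := diagonal_vectors) _) _.
  by move=> j hj; rewrite /walk_law (diagonal_run hj).
rewrite back_green_diagonal green_diagonal0 count_diagonal_diagonal_start//.
by rewrite (addnC (B _)); exact: diagonal_estimate.
Qed.

Lemma block_bound n :
  (P (zero_between S (A n.+1 + B n) (A n.+2 + B n.+1))
     <= 12%:E * (horizontal_term R a b n.+1 + diagonal_term R a b n.+1))%E.
Proof.
have mZ k l := measurable_zero_between (walk_random_vector walkS) k l.
rewrite ge0_muleDr ?horizontal_term_ge0 ?diagonal_term_ge0//.
apply: (le_trans _ (leeD (horizontal_run_bound n) (diagonal_run_bound n))).
apply: le_trans (measureU2 _ (mZ _ _) (mZ _ _)).
rewrite le_measure ?inE//; first exact: measurableU.
move=> w [j /= /andP[hj1 hj2] Sj].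
have [h|h] := leqP j (A n.+1 + B n.+1); [left|right]; exists j => //=.
  by rewrite hj1.
by rewrite ltnW.
Qed.

Lemma transient_of_series :
  (horizontal_series R a b < +oo)%E -> (diagonal_series R a b < +oo)%E ->
  transient P S.
Proof.
move=> hH hD.
pose c n := (A n.+1 + B n)%N.
have cS n : (c n < c n.+1)%N.
  by rewrite /c (psumS a n.+1) (psumS b); have := bpos (ltn0Sn n); lia.
pose F n := zero_between S (c n) (c n.+1).
have mF n : measurable (F n).
  exact: (measurable_zero_between (walk_random_vector walkS)).
have F_summable : (\sum_(n <oo) P (F n) < +oo)%E.
  pose u n := (horizontal_term R a b n + diagonal_term R a b n)%E.
  have u0 n : (0 <= u n)%E.
    by rewrite adde_ge0 ?horizontal_term_ge0 ?diagonal_term_ge0.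
  apply: (@le_lt_trans _ _ (\sum_(n <oo) 12%:E * u (n + 1)%N)%E).
    by apply: lee_nneseries => [//|n _]; rewrite addn1; exact: block_bound.
  rewrite nneseriesZl; last by move=> n _; exact: u0.
  rewrite (nneseries_addn 1 u0) nneseriesD; last 2 first.
  - by move=> n _ _; exact: horizontal_term_ge0.
  - by move=> n _ _; exact: diagonal_term_ge0.
  by rewrite lte_mul_pinfty ?lte_add_pinfty// lee_fin.
have limsup0 : P (lim_sup_set F) = 0 by exact: lim_sup_set_cvg0.
have mL : measurable (lim_sup_set F).
  by apply: bigcap_measurableType => n _; exact: bigcup_measurable.
apply: (@negligibleS _ _ _ _ (lim_sup_set F)); last exact/negligibleP.
move=> w /= infinite n _; apply: contrapT => noF; apply: infinite.
apply: (@sub_finite_set _ _ `I_(c n)); last exact: finite_II.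
move=> k /= Sk; rewrite ltnNge; apply/negP => ck.
have [||m /andP[m1 m2]] := @increasing_cover (fun i => c (n + i)%N) k.
- by move=> i; rewrite addnS; exact: cS.
- by rewrite addn0.
apply: noF; exists (n + m)%N; first by rewrite /= leq_addr.
by exists k => //=; rewrite m1 /= -addnS ltnW.
Qed.

End transience.

(** * Squares and powers of two *)

Section example.
Variable R : realType.

Lemma telescoping_series_lty (u : nat -> \bar R) (v : nat -> R) :
  (forall n, 0 <= u n)%E -> (forall n, 0 <= v n) ->
  (forall n, (0 < n)%N -> (u n <= (v n - v n.+1)%:E)%E) ->
  (\sum_(1 <= n <oo) u n < +oo)%E.
Proof.
move=> u0 v0 uv; apply: (@le_lt_trans _ _ (v 1%N)%:E); last exact: ltry.
apply: lime_le; first by apply: is_cvg_nneseries => n _ _; exact: u0.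
apply: nearW => N.
have [N1|N1] := leqP N 1; first by rewrite big_geq// lee_fin.
apply: (@le_trans _ _ (\sum_(1 <= n < N) (v n - v n.+1)%:E)%E).
  by rewrite !big_nat; apply: lee_sum => n /andP[n1 _]; exact: uv.
rewrite sumEFin lee_fin.
rewrite (eq_bigr (fun n => - (v n.+1 - v n))); last by move=> n _; rewrite opprB.
by rewrite sumrN telescope_sumr ?(ltnW N1)// opprB lerBlDr lerDl.
Qed.

Lemma psum_sqr_ge n : (n ^ 3 <= 3 * psum (fun n => n ^ 2) n)%N.
Proof. by elim: n => [|n IH]; rewrite ?psum0 ?psumS//; lia. Qed.

Lemma psum_exp2_ge n : (0 < n)%N -> (2 ^ n <= psum (fun n => 2 ^ n) n)%N.
Proof. by case: n => [//|n] _; rewrite psumS leq_addl. Qed.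

Lemma sqrtD_le (x y : R) : 0 <= x -> 0 <= y ->
  Num.sqrt (x + y) <= Num.sqrt x + Num.sqrt y.
Proof.
move=> x0 y0; rewrite -[leRHS]ger0_norm ?addr_ge0 ?sqrtr_ge0// -sqrtr_sqr.
rewrite ler_wsqrtr// sqrrD !sqr_sqrtr// addrAC lerDl.
by rewrite mulrn_wge0// mulr_ge0 ?sqrtr_ge0.
Qed.

(** The second factor of each term is at most 1 by subadditivity of the square
    root, and A_n >= n^3 / 4 makes the first at most 2 n^{-3/2}, which is
    dominated by the increments of 8 n^{-1/2}. *)
Lemma horizontal_series_example :
  (horizontal_series R (fun n => n ^ 2)%N (fun n => 2 ^ n)%N < +oo)%E.
Proof.
rewrite /horizontal_series.
set A := psum (fun n => n ^ 2)%N; set B := psum (fun n => 2 ^ n)%N.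
apply: (@telescoping_series_lty _ (fun n => 8 / Num.sqrt n%:R)) => n.
- exact: (horizontal_term_ge0 R (fun n => n ^ 2)%N (fun n => 2 ^ n)%N n).
- by rewrite divr_ge0 ?sqrtr_ge0.
move=> n0; rewrite lee_fin.
have s0 : 0 < Num.sqrt n%:R :> R by rewrite sqrtr_gt0 ltr0n.
have s'0 : 0 < Num.sqrt n.+1%:R :> R by rewrite sqrtr_gt0.
have hA : (Num.sqrt n%:R) ^+ 3 / 2 <= Num.sqrt (A n)%:R :> R.
  rewrite -[leLHS]ger0_norm ?divr_ge0 ?exprn_ge0 ?sqrtr_ge0// -sqrtr_sqr.
  rewrite ler_wsqrtr// expr_div_n exprAC sqr_sqrtr// ler_pdivrMr ?exprn_gt0//.
  by rewrite -!natrX -natrM ler_nat; have := psum_sqr_ge n; rewrite -/A; lia.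
have hA0 : 0 < Num.sqrt (A n)%:R :> R.
  by apply: lt_le_trans hA; rewrite divr_gt0 ?exprn_gt0.
apply: (@le_trans _ _ (Num.sqrt (A n)%:R)^-1).
  rewrite ler_piMr ?invr_ge0 ?sqrtr_ge0//.
  rewrite ler_pdivrMr ?sqrtr_gt0 ?ltr0n ?expn_gt0//.
  rewrite mul1r lerBlDl; case: n n0 {s0 s'0 hA hA0} => [//|n] _ /=.
  by rewrite {1}/B psumS addnA natrD; exact: sqrtD_le.
apply: (@le_trans _ _ (Num.sqrt n%:R ^+ 3 / 2)^-1).
  by rewrite lef_pV2 ?posrE// divr_gt0 ?exprn_gt0.
have hinc := sqrtS_sub_ge R n.
have hs : Num.sqrt n.+1%:R ^+ 2 <= 2 * Num.sqrt n%:R ^+ 2 :> R.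
  by rewrite !sqr_sqrtr// -natrM ler_nat; lia.
move: s0 s'0 hinc hs; set s := Num.sqrt n%:R; set s' := Num.sqrt _.
move=> s0 s'0 hinc hs.
have -> : 8 / s - 8 / s' = 8 * (s' - s) / (s * s').
  by field; rewrite !gt_eqF.
apply: (@le_trans _ _ (8 * (2 * s')^-1 / (s * s'))); last first.
  by rewrite ler_pM2r ?invr_gt0 ?mulr_gt0// ler_pM2l.
have -> : 8 * (2 * s')^-1 / (s * s') = 4 / (s * s' ^+ 2).
  by field; rewrite !gt_eqF.
apply: (@le_trans _ _ (4 / (s * (2 * s ^+ 2)))).
  by rewrite [leRHS](_ : _ = (s ^+ 3 / 2)^-1)//; field; rewrite gt_eqF.
rewrite ler_pM2l// lef_pV2 ?posrE ?mulr_gt0 ?exprn_gt0//.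
by rewrite ler_pM2l.
Qed.

(** With r_n = (2^n)^{-1/2} each of the (n+1)^2 summands is at most r_n.  Since
    r_{n+1} <= 3/4 r_n, the product (n+1)^2 r_n is at most an increment of
    r_n q(n) as soon as q(n) - 3/4 q(n+1) >= (n+1)^2, and
    q(n) = 4 n^2 + 32 n + 112 solves this with equality. *)
Lemma diagonal_series_example :
  (diagonal_series R (fun n => n ^ 2)%N (fun n => 2 ^ n)%N < +oo)%E.
Proof.
rewrite /diagonal_series.
set A := psum (fun n => n ^ 2)%N; set B := psum (fun n => 2 ^ n)%N.
pose r n : R := (Num.sqrt (2 ^ n)%:R)^-1.
pose v n : R := (ln 4)^-1 * (r n * (4 * n%:R ^+ 2 + 32 * n%:R + 112)).
have r0 n : 0 < r n by rewrite invr_gt0 sqrtr_gt0 ltr0n expn_gt0.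
have rS n : r n.+1 <= 3 / 4 * r n.
  rewrite /r expnS natrM sqrtrM// invfM ler_pM2r//.
  rewrite -[leRHS]invrK lef_pV2 ?posrE ?sqrtr_gt0 ?invr_gt0 ?divr_gt0//.
  rewrite invf_div -[leLHS]ger0_norm ?divr_ge0// -sqrtr_sqr ler_wsqrtr//; lra.
have ln4 : 0 < ln 4 :> R by rewrite ln_gt0// ltr1n.
have ln_sqr n : (0 < n)%N -> ln 4 <= ln (n.+1 ^ 2)%:R :> R.
  by move=> n0; rewrite ler_ln ?posrE ?ltr0n ?expn_gt0// ler_nat; lia.
apply: (@telescoping_series_lty _ v) => n.
- exact: (diagonal_term_ge0 R (fun n => n ^ 2)%N (fun n => 2 ^ n)%N n).
- by rewrite /v !mulr_ge0 ?invr_ge0 ?(ltW ln4) ?(ltW (r0 n))//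
    !addr_ge0 ?mulr_ge0 ?exprn_ge0.
move=> n0; rewrite inver gt_eqF -?EFinM ?lee_fin; last first.
  exact: lt_le_trans (ln_sqr n n0).
apply: (@le_trans _ _ ((ln 4)^-1 * (r n * n.+1%:R ^+ 2))).
  apply: ler_pM.
  - by rewrite invr_ge0 (le_trans (ltW ln4))// ln_sqr.
  - by apply: sumr_ge0 => j _; rewrite mulr_ge0 ?powR_ge0.
  - by rewrite lef_pV2 ?posrE ?ln_sqr// (lt_le_trans ln4)// ln_sqr.
  rewrite big_add1 big_mkord.
  apply: (@le_trans _ _ (\sum_(j < n.+1 ^ 2) r n)); last first.
    by rewrite sumr_const card_ord -natrX mulr_natr.
  apply: ler_sum => j _; rewrite !powRN !powR12_sqrt// -[leRHS]mulr1.
  apply: ler_pM; rewrite ?invr_ge0 ?sqrtr_ge0//.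
    apply: invsqrt_le; first by rewrite expn_gt0.
    by have := psum_exp2_ge n0; rewrite -/B; lia.
  have := @invsqrt_le R 1 (A n + j.+1) isT; rewrite sqrtr1 invr1; apply; lia.
rewrite /v -mulrBr ler_pM2l ?invr_gt0//.
have := rS n; have := r0 n; have := ler0n R n; rewrite -(natr1 n).
move: (r n) (r n.+1) (n%:R : R) => x y z z0 x0 yx.
have hq : 0 <= 4 * (z + 1) ^+ 2 + 32 * (z + 1) + 112.
  by rewrite !addr_ge0 ?mulr_ge0 ?exprn_ge0 ?addr_ge0.
have := ler_wpM2r hq yx; nra.
Qed.

End example.

Theorem proposition4p1 (R : realType) :
  (forall (a b : nat -> nat), positive_seq a -> positive_seq b ->
    (horizontal_series R a b < +oo)%E ->
    (diagonal_series R a b < +oo)%E ->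
    forall (d : measure_display) (T : measurableType d) (P : probability T R)
      (S : nat -> T -> Z2),
      diag_horiz_walk P a b S -> transient P S) /\
  (horizontal_series R (fun n => n ^ 2)%N (fun n => 2 ^ n)%N < +oo)%E /\
  (diagonal_series R (fun n => n ^ 2)%N (fun n => 2 ^ n)%N < +oo)%E.
Proof.
split; last first.
  by split; [exact: horizontal_series_example|exact: diagonal_series_example].
move=> a b apos bpos hH hD d T P S walkS.
exact: (transient_of_series apos bpos walkS hH hD).
Qed.
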